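(* Let $d\in\mathbb{N}$. The ring $\mathcal{S}'(\mathbb{Z}^d)$ is a Hermite ring.
   Context: $\mathbb{N}=\{1,2,3,\dots\}$. For $\mathbf{n}=(n_1,\dots,n_d)\in\mathbb{Z}^d$ write $|\mathbf{n}|_1:=|n_1|+\cdots+|n_d|$. The set $\mathcal{S}'(\mathbb{Z}^d)$ consists of all maps $\mathbf{a}:\mathbb{Z}^d\to\mathbb{C}$ of at most polynomial growth, i.e. such that there exist a real $M>0$ and $k\in\mathbb{N}$ with $|\mathbf{a}(\mathbf{n})|\le M(1+|\mathbf{n}|_1)^k$ for all $\mathbf{n}\in\mathbb{Z}^d$. With pointwise addition and multiplication it is a commutative unital ring. A commutative unital ring $R$ is called Hermite if every finitely generated stably free $R$-module is free. *)

(* Defs.v *)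
From HB Require Import structures.
From mathcomp Require Import all_boot all_order all_algebra.
From mathcomp Require Import boolp classical_sets functions reals.
From mathcomp Require Import complex.

Set Implicit Arguments.
Unset Strict Implicit.
Unset Printing Implicit Defensive.

Import Order.TTheory GRing.Theory Num.Theory.
Local Open Scope ring_scope.

Section Modules.
Variable A : comPzRingType.
Implicit Type M : lmodType A.

Definition finitely_generated M : Prop :=
  exists (n : nat) (g : 'I_n -> M),
    forall x : M, exists c : 'I_n -> A, x = \sum_(i < n) c i *: g i.

Definition stably_free M : Prop :=
  exists (m n : nat) (f : {linear (M * 'rV[A]_m)%type -> 'rV[A]_n}),
    bijective f.

(* The index type of a basis may be infinite. *)
Definition is_basis M (I : choiceType) (b : I -> M) : Prop :=
  (forall x : M, exists (s : seq I) (c : I -> A), x = \sum_(i <- s) c i *: b i)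
  /\ (forall (s : seq I) (c : I -> A), uniq s ->
        \sum_(i <- s) c i *: b i = 0 -> {in s, forall i, c i = 0}).

Definition free_module M : Prop :=
  exists (I : choiceType) (b : I -> M), is_basis b.

Definition hermite_ring : Prop :=
  forall M : lmodType A,
    finitely_generated M -> stably_free M -> free_module M.

End Modules.

Definition norm1 (d : nat) (n : 'rV[int]_d) : nat := (\sum_(i < d) `|n 0%R i|)%N.

(* The inequality is between elements of R[i]; its right-hand side is real. *)
Definition polynomial_growth (R : realType) (d : nat) (a : 'rV[int]_d -> R[i]) :
    Prop :=
  exists (M : R) (k : nat), [/\ 0 < M, (0 < k)%N &
    forall n : 'rV[int]_d, `|a n| <= (M * (1 + (norm1 n)%:R) ^+ k)%:C%C].

Definition tempered_pred (R : realType) (d : nat) :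
    {pred 'rV[int]_d -> R[i]} :=
  fun a => `[< polynomial_growth a >].

Section TemperedRing.
Variables (R : realType) (d : nat).
Implicit Types a b : 'rV[int]_d -> R[i].

Lemma norm1_ge1 (n : 'rV[int]_d) : 1 <= 1 + (norm1 n)%:R :> R.
Proof. by rewrite lerDl ler0n. Qed.

Lemma polynomial_growth1 : polynomial_growth (1 : 'rV[int]_d -> R[i]).
Proof.
exists 1, 1%N; split => // n.
have -> : (1 : 'rV[int]_d -> R[i]) n = 1 by [].
by rewrite normr1 mul1r expr1 lecR norm1_ge1.
Qed.

Lemma polynomial_growthB a b :
  polynomial_growth a -> polynomial_growth b -> polynomial_growth (a - b).
Proof.
move=> [M [k [M0 k0 Ha]]] [N [l [N0 l0 Hb]]].
exists (M + N), (k + l)%N; split; rewrite ?addr_gt0 ?addn_gt0 ?k0 // => n.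
have -> : (a - b) n = a n - b n by [].
apply: le_trans (ler_normB _ _) _.
apply: le_trans (lerD (Ha n) (Hb n)) _.
rewrite -rmorphD lecR mulrDl lerD // ler_pM2l //.
- by rewrite ler_weXn2l ?norm1_ge1 // leq_addr.
- by rewrite ler_weXn2l ?norm1_ge1 // leq_addl.
Qed.

Lemma polynomial_growthM a b :
  polynomial_growth a -> polynomial_growth b -> polynomial_growth (a * b).
Proof.
move=> [M [k [M0 k0 Ha]]] [N [l [N0 l0 Hb]]].
exists (M * N), (k + l)%N; split; rewrite ?mulr_gt0 ?addn_gt0 ?k0 // => n.
have -> : (a * b) n = a n * b n by [].
rewrite normrM exprD mulrACA rmorphM.
exact: ler_pM (normr_ge0 _) (normr_ge0 _) (Ha n) (Hb n).
Qed.

Lemma tempered_subring : subring_closed (@tempered_pred R d).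
Proof.
split.
- exact/asboolP/polynomial_growth1.
- by move=> a b /asboolP Ha /asboolP Hb; apply/asboolP/polynomial_growthB.
- by move=> a b /asboolP Ha /asboolP Hb; apply/asboolP/polynomial_growthM.
Qed.

HB.instance Definition _ :=
  GRing.isSubringClosed.Build _ (@tempered_pred R d) tempered_subring.

(* The ring S'(Z^d), a subring of the pointwise ring of functions. *)
Record tempered := Tempered {
  tempered_val :> 'rV[int]_d -> R[i];
  _ : tempered_val \in @tempered_pred R d }.

HB.instance Definition _ := [isSub for tempered_val].
HB.instance Definition _ := [Choice of tempered by <:].
HB.instance Definition _ :=
  GRing.SubChoice_isSubComPzRing.Build _ _ tempered tempered_subring.

Lemma tempered_oner_neq0 : (1 : tempered) != 0.
Proof.
apply/eqP => /(congr1 (fun u : tempered => tempered_val u 0)).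
by move/eqP; rewrite oner_eq0.
Qed.

HB.instance Definition _ :=
  GRing.PzSemiRing_isNonZero.Build tempered tempered_oner_neq0.

End TemperedRing.

(* Main.v *)
Require Import Defs.
From HB Require Import structures.
From mathcomp Require Import all_boot all_order all_algebra.
From mathcomp Require Import spectral.
From mathcomp Require Import boolp reals complex.

Import Order.TTheory GRing.Theory Num.Theory.
Local Open Scope ring_scope.
Local Open Scope sesquilinear_scope.

(** If M (+) A^m ~ A^n, then M is the kernel of a split surjection A^n -> A^m.
    Evaluated at a point p of Z^d this surjection becomes a complex n x m matrix
    of rank m, whose kernel has an orthonormal basis, i.e. the rows of some
    matrix U(p) with U(p) U(p)^* = 1. The entries of U(p) have modulus at most 1,
    so any choice of U(p), p in Z^d, is a tempered matrix U, with tempered right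
    inverse U^*, and the rows of U form a basis of M. *)

(** Matrices act on row vectors from the right, so [C] is a section of [v |-> v *m B]. The rows of
    [U] are a basis of the kernel of this map, and [v *m V] gives the coordinates of [v] in it. *)
Definition split_kernels_free (A : comPzRingType) : Prop :=
  forall (m n : nat) (B : 'M[A]_(n, m)) (C : 'M[A]_(m, n)), C *m B = 1%:M ->
  exists (k : nat) (U : 'M[A]_(k, n)) (V : 'M[A]_(n, k)),
    [/\ U *m V = 1%:M, U *m B = 0 &
        forall v : 'rV[A]_n, v *m B = 0 -> v *m V *m U = v].

Lemma split_kernels_free_hermite (A : comPzRingType) :
  split_kernels_free A -> hermite_ring A.
Proof.
move=> kerA M _ [m [n [f [g fK gK]]]].
pose g_lin := GRing.isLinear.Build A _ _ _ g (can2_linear fK gK).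
pose gl : {linear _ -> _} := HB.pack g g_lin.
(* [B] is the matrix of the projection of A^n onto the summand A^m, whose kernel is the copy of [M]
   in A^n. The inclusion of A^m, followed by [f], is a section. *)
pose B := lin1_mx (snd \o gl).
pose inr0 (w : 'rV[A]_m) : (M * 'rV[A]_m)%type := (0, w).
have inr0_lin : linear inr0.
  by move=> a u v; congr (_, _); rewrite /= scaler0 addr0.
pose h_lin := GRing.isLinear.Build A _ _ _ inr0 inr0_lin.
pose h : {linear _ -> _} := HB.pack inr0 h_lin.
have mulB v : v *m B = (g v).2 by rewrite /B mul_rV_lin1.
have CB : lin1_mx (f \o h) *m B = 1%:M.
  apply/row_matrixP => i; rewrite row_mul row1 rowE !mul_rV_lin1 /=.
  by rewrite fK.
have [k [U [V [UV UB UVid]]]] := kerA m n B _ CB.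
have g1_sum (c : 'I_k -> A) : (g (\row_i c i *m U)).1
    = \sum_i c i *: (gl (row i U)).1.
  rewrite -[g]/(gl : _ -> _) mulmx_sum_row linear_sum raddf_sum.
  by apply: eq_bigr => i _; rewrite linearZ /= mxE.
exists 'I_k, (fun i => (gl (row i U)).1); split=> [x|s c s_uniq].
  pose v := f (x, 0).
  have vB : v *m B = 0 by rewrite mulB fK.
  exists (index_enum 'I_k), (fun i => (v *m V) 0 i).
  rewrite -g1_sum (_ : \row_i _ = v *m V); last by apply/rowP=> i; rewrite mxE.
  by rewrite UVid // fK.
rewrite big_uniq // big_mkcond /= => sum0.
(* Extending [c] by zero turns a relation over [s] into one among all rows of [U]. *)
pose c' i := if i \in s then c i else 0.
have c'0 : \row_i c' i *m U = 0.
  apply: (can_inj gK); rewrite -[g]/(gl : _ -> _) linear0.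
  (* The component in A^m vanishes because [U *m B = 0]; the component in [M] vanishes by the given
     relation. *)
  rewrite [LHS]surjective_pairing -mulB -mulmxA UB mulmx0; congr (_, _).
  rewrite g1_sum -[RHS]sum0; apply: eq_bigr => i _.
  by rewrite /c'; case: ifP => //; rewrite scale0r.
move=> i si; have /rowP/(_ i) : \row_i c' i = 0.
  by rewrite -[LHS]mulmx1 -UV mulmxA c'0 mul0mx.
by rewrite !mxE /c' si.
Qed.

(** Gram-Schmidt is applied to a basis of the kernel. With [k] as a parameter, kernels at different
    points get matrices of one common size. *)
Lemma unitary_kernel_basis (C : numClosedFieldType) (m n k : nat)
    (B : 'M[C]_(n, m)) : \rank (kermx B) = k ->
  exists U : 'M[C]_(k, n), [/\ U \is unitarymx, U *m B = 0 &
    forall v : 'rV[C]_n, v *m B = 0 -> v *m U^t* *m U = v].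
Proof.
move=> <-; set r := \rank _; pose U := schmidt (row_base (kermx B)).
have r_le_n : (r <= n)%N by exact: rank_leq_col.
have U_unit : U \is unitarymx by exact: schmidt_unitarymx.
have eqU : (U :=: kermx B)%MS.
  apply: eqmx_trans (eq_row_base _).
  by apply: eqmx_schmidt_free; rewrite ?row_base_free.
exists U; split=> // [|v vB]; first by apply/sub_kermxP; rewrite eqU.
(* Since [v = w *m U], multiplying by the adjoint of [U] recovers [w]. *)
have /submxP [w ->] : (v <= U)%MS by rewrite eqU; apply/sub_kermxP.
by rewrite mulmxtVK.
Qed.

(** The squared moduli of the entries of a row add up to 1. *)
Lemma unitarymx_entry_le1 (C : numClosedFieldType) (k n : nat)
    (U : 'M[C]_(k, n)) i j : U \is unitarymx -> `|U i j| <= 1.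
Proof.
move=> /unitarymxP /matrixP /(_ i i); rewrite !mxE eqxx => UU.
rewrite -(@expr_le1 _ 2) // -[leRHS]UU (bigD1 j) //= !mxE normCK lerDl.
by apply: sumr_ge0 => l _; rewrite !mxE mul_conjC_ge0.
Qed.

Section TemperedEvaluation.
Variables (R : realType) (d : nat).

Definition tempered_eval (p : 'rV[int]_d) (a : tempered R d) : R[i] := a p.

Fact tempered_eval_zmod_morphism p : zmod_morphism (tempered_eval p).
Proof. by []. Qed.
Fact tempered_eval_monoid_morphism p : monoid_morphism (tempered_eval p).
Proof. by []. Qed.

HB.instance Definition _ p := GRing.isZmodMorphism.Build _ _ (tempered_eval p)
  (tempered_eval_zmod_morphism p).
HB.instance Definition _ p := GRing.isMonoidMorphism.Build _ _ (tempered_eval p)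
  (tempered_eval_monoid_morphism p).

Lemma tempered_mxP (m n : nat) (A B : 'M[tempered R d]_(m, n)) :
  (forall p, map_mx (tempered_eval p) A = map_mx (tempered_eval p) B) -> A = B.
Proof.
move=> AB; apply/matrixP=> i j; apply: val_inj; apply/funext => p.
by have /matrixP/(_ i j) := AB p; rewrite !mxE.
Qed.

Lemma bounded_tempered (a : 'rV[int]_d -> R[i]) :
  (forall p, `|a p| <= 1) -> a \in @tempered_pred R d.
Proof.
move=> a1; apply/asboolP; exists 1, 1%N; split=> // p.
by apply: le_trans (a1 p) _; rewrite mul1r expr1 lecR norm1_ge1.
Qed.

(** The values at different points may be chosen independently; only the uniform bound matters. *)
Lemma bounded_tempered_mx (m n : nat) (A : 'rV[int]_d -> 'M[R[i]]_(m, n)) :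
  (forall p i j, `|A p i j| <= 1) ->
  exists T : 'M[tempered R d]_(m, n), forall p, map_mx (tempered_eval p) T = A p.
Proof.
move=> A1; exists (\matrix_(i, j)
  Tempered (bounded_tempered (fun p => A p i j) (fun p => A1 p i j))).
by move=> p; apply/matrixP=> i j; rewrite !mxE.
Qed.

Lemma tempered_split_kernels_free : split_kernels_free (tempered R d).
Proof.
move=> m n B C CB; pose Bp p := map_mx (tempered_eval p) B.
(* The identity [C *m B = 1%:M] survives evaluation, so the rank is [m] and the kernel has dimension
   [n - m] at every point. *)
have rankB p : \rank (Bp p) = m.
  apply/eqP; rewrite eqn_leq rank_leq_col /= -{1}(mxrank1 R[i] m).
  by rewrite -(map_mx1 (tempered_eval p)) -CB map_mxM mxrankM_maxr.
have kerB p : \rank (kermx (Bp p)) = (n - m)%N by rewrite mxrank_ker rankB.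
have [U U_spec] := choice (fun p => unitary_kernel_basis _ _ _ _ _ (kerB p)).
have U1 p i j : `|U p i j| <= 1.
  by have [+ _ _] := U_spec p; exact: unitarymx_entry_le1.
have Ut1 p i j : `|(U p)^t* i j| <= 1 by rewrite !mxE norm_conjC U1.
have [W WE] := bounded_tempered_mx _ _ U U1.
have [V VE] := bounded_tempered_mx _ _ (fun p => (U p)^t*) Ut1.
exists (n - m)%N, W, V; split=> [||v vB]; apply: tempered_mxP => p;
  have [/unitarymxP UU UB UUid] := U_spec p.
- by rewrite map_mxM WE VE UU map_mx1.
- by rewrite map_mxM WE UB map_mx0.
- rewrite !map_mxM WE VE UUid // -map_mxM vB.
  exact: map_mx0.
Qed.

End TemperedEvaluation.

Theorem theorem5p1 (R : realType) (d : nat) (hd : (0 < d)%N) :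
  @hermite_ring (tempered R d).
Proof.
exact/split_kernels_free_hermite/tempered_split_kernels_free.
Qed.
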